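(* Let $R$ be a commutative ring with identity and let $M$ be a unital $R$-module. Then the idealization $R(+)M$ is ACCP if and only if $R$ is ACCP and $M$ is ACCC.
   Context: All rings are commutative with identity and all modules are unital. The idealization $R(+)M$ of an $R$-module $M$ is the ring with underlying set $R\times M$, componentwise addition, and multiplication $(r_1,x_1)(r_2,x_2)=(r_1r_2,\ r_1x_2+r_2x_1)$. A ring is called ACCP if every ascending chain of principal ideals stabilizes. A module is called ACCC if every ascending chain of cyclic submodules stabilizes. *)

(* Defs.v *)
From HB Require Import structures.
From mathcomp Require Import all_boot all_order all_algebra.
From mathcomp Require Import classical_sets.

Set Implicit Arguments.
Unset Strict Implicit.
Unset Printing Implicit Defensive.

Import GRing.Theory.
Local Open Scope classical_set_scope.
Local Open Scope ring_scope.

(* R(+)M: an alias of the product type, so that it carries its own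
   multiplication while inheriting the componentwise additive structure. The
   scalar action is a left one, so r1 x2 + r2 x1 reads r1 *: x2 + r2 *: x1. *)
Definition idealization (R : comPzRingType) (M : lmodType R) : Type :=
  (R * M)%type.

Section IdealizationRing.
Variables (R : comPzRingType) (M : lmodType R).
Implicit Types u v w : idealization M.

HB.instance Definition _ := GRing.Zmodule.copy (idealization M) (R * M)%type.

Definition idealization_one : idealization M := (1, 0).

Definition idealization_mul u v : idealization M :=
  (u.1 * v.1, u.1 *: v.2 + v.1 *: u.2).

Fact idealization_mulA : associative idealization_mul.
Proof.
move=> u v w; congr pair; rewrite /= ?mulrA //.
by rewrite !scalerDr !scalerA addrA (mulrC w.1 u.1) (mulrC w.1 v.1).
Qed.

Fact idealization_mulC : commutative idealization_mul.
Proof. by move=> u v; congr pair; rewrite /= 1?mulrC // addrC. Qed.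

Fact idealization_mul1 : left_id idealization_one idealization_mul.
Proof.
by case=> r x; congr pair; rewrite /= ?mul1r // scale1r scaler0 addr0.
Qed.

Fact idealization_mulDl : left_distributive idealization_mul +%R.
Proof.
move=> u v w; congr pair; rewrite /= ?mulrDl //.
by rewrite scalerDl scalerDr addrACA.
Qed.

HB.instance Definition _ := GRing.Zmodule_isComPzRing.Build (idealization M)
  idealization_mulA idealization_mulC idealization_mul1 idealization_mulDl.

End IdealizationRing.

Arguments idealization R M : clear implicits.

Definition principal_ideal (R : comPzRingType) (a : R) : set R :=
  [set r * a | r in [set: R]].

Definition cyclic_submodule (R : comPzRingType) (M : lmodType R) (x : M) :
    set M :=
  [set r *: x | r in [set: R]].

Definition ascending_chain_condition (T : Type) (F : set (set T)) : Prop :=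
  forall I : nat -> set T,
    (forall n, F (I n)) ->
    (forall n, I n `<=` I n.+1) ->
    exists N : nat, forall n : nat, (N <= n)%N -> I n = I N.

Definition ACCP (R : comPzRingType) : Prop :=
  ascending_chain_condition [set principal_ideal a | a in [set: R]].

Definition ACCC (R : comPzRingType) (M : lmodType R) : Prop :=
  ascending_chain_condition [set cyclic_submodule x | x in [set: M]].

Arguments ACCC R M : clear implicits.

(* Main.v *)
Require Import Defs.
From mathcomp Require Import all_boot all_order all_algebra.
From mathcomp Require Import boolp classical_sets.
From mathcomp Require Import ring.

(* Let (a_n, x_n) = (r_n, m_n) (a_{n+1}, x_{n+1}) in R(+)M. Once a_{n+1} = s_n a_n,
   multiplying (a_n, x_n) by the unit (1, u_n) with u_{n+1} = u_n + s_n m_n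
   replaces x_n by y_n = x_n + a_n u_n, and now y_n = r_n y_{n+1} with the same
   r_n as in a_n = r_n a_{n+1}. By ACCC, y_{n+1} = p_n y_n eventually. As 1 - p_n r_n
   kills y_{n+1} and 1 - s_n r_n kills a_{n+1}, their product 1 - q_n r_n kills both,
   so that (a_{n+1}, y_{n+1}) = q_n (a_n, y_n). *)

Import GRing.Theory.
Local Open Scope classical_set_scope.
Local Open Scope ring_scope.

Lemma cyclic_submodule_subP (R : comPzRingType) (M : lmodType R) (x y : M) :
  cyclic_submodule x `<=` cyclic_submodule y <-> exists r : R, x = r *: y.
Proof.
split=> [sub|[r ->] _ [t _ <-]]; last by exists (t * r); rewrite ?scalerA.
have [|r _ ry] := sub x; first by exists 1; rewrite ?scale1r.
by exists r.
Qed.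

(** Choosing a generator for each term turns a chain into a sequence; stabilization then amounts to
    reversing each divisibility between consecutive generators from some index on. *)
Lemma ACCC_seqP (R : comPzRingType) (M : lmodType R) :
  ACCC R M <-> forall x : nat -> M,
    (forall n, exists r : R, x n = r *: x n.+1) ->
    exists N, forall n, (N <= n)%N -> exists s : R, x n.+1 = s *: x n.
Proof.
split=> [accM x x_asc | accM I I_cyc I_asc].
  have [| |N stab] := accM (fun n => cyclic_submodule (x n)).
  - by move=> n; exists (x n).
  - by move=> n; apply/cyclic_submodule_subP.
  exists N => n leNn; apply/cyclic_submodule_subP.
  by rewrite stab ?stab // leqW.
have /choice[x Ix] n : exists y : M, cyclic_submodule y = I n.
  by have [y _ <-] := I_cyc n; exists y.
have [n|N stab] := accM x.
  by apply/cyclic_submodule_subP; rewrite !Ix.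
exists N; elim=> [|n IHn]; first by rewrite leqn0 => /eqP->.
rewrite leq_eqVlt => /predU1P[<- //|leNn]; rewrite -IHn //.
apply/seteqP; split; last exact: I_asc.
by rewrite -!Ix; apply/cyclic_submodule_subP/stab.
Qed.

Lemma ACCP_seqP (R : comPzRingType) :
  ACCP R <-> forall a : nat -> R,
    (forall n, exists r, a n = r * a n.+1) ->
    exists N, forall n, (N <= n)%N -> exists s, a n.+1 = s * a n.
(* Principal ideals of [R] are the cyclic submodules of the regular module [R^o]. *)
Proof. exact: (ACCC_seqP R R^o). Qed.

Lemma ACCP_idealization_base (R : comPzRingType) (M : lmodType R) :
  ACCP (idealization R M) -> ACCP R.
Proof.
move=> /ACCP_seqP accZ; apply/ACCP_seqP => a a_asc.
have [n|N stab] := accZ (fun n => (a n, 0) : idealization R M).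
  have [r ->] := a_asc n; exists (r, 0).
  by congr pair; rewrite /= !scaler0 addr0.
by exists N => n /stab[[s m] [-> _]]; exists s.
Qed.

Lemma ACCP_idealization_module (R : comPzRingType) (M : lmodType R) :
  ACCP (idealization R M) -> ACCC R M.
Proof.
move=> /ACCP_seqP accZ; apply/ACCC_seqP => x x_asc.
have [n|N stab] := accZ (fun n => (0, x n) : idealization R M).
  have [r ->] := x_asc n; exists (r, 0).
  by congr pair; rewrite /= ?mulr0 // scaler0 addr0.
(* The component [m] acts only through [0 *: m], so [s] alone is the multiplier. *)
exists N => n /stab[[s m] [_ xn]]; exists s.
by rewrite xn /= scale0r addr0.
Qed.

Lemma common_multiplier (R : comPzRingType) (M : lmodType R)
    (r s p a b : R) (x y : M) :
    a = r * b -> b = s * a -> x = r *: y -> y = p *: x ->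
  exists q, b = q * a /\ y = q *: x.
Proof.
(* The witness solves [1 - q * r = (1 - p * r) * (1 - s * r)] for [q]. *)
move=> ab ba xy yx; exists (p + s - p * r * s); split.
  have bE : b = s * r * b by rewrite -mulrA -ab.
  rewrite ab; transitivity (s * r * b + p * r * (b - s * r * b)); last by ring.
  by rewrite -bE subrr mulr0 addr0.
have yE : y = (p * r) *: y by rewrite -scalerA -xy.
have -> : p + s - p * r * s = p + s * (1 - p * r) by ring.
rewrite scalerDl -yx xy scalerA.
have -> : s * (1 - p * r) * r = s * r * (1 - p * r) by ring.
by rewrite -scalerA scalerBl scale1r -yE subrr scaler0 addr0.
Qed.

Lemma ACCP_idealization (R : comPzRingType) (M : lmodType R) :
  ACCP R -> ACCC R M -> ACCP (idealization R M).
Proof.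
move=> /ACCP_seqP accR /ACCC_seqP accM; apply/ACCP_seqP => z /choice[c zE].
have aE n : (z n).1 = (c n).1 * (z n.+1).1 by rewrite {1}zE.
have xE n : (z n).2 = (c n).1 *: (z n.+1).2 + (z n.+1).1 *: (c n).2.
  by rewrite {1}zE.
have [n|N stabR] := accR (fun n => (z n).1); first by exists (c n).1.
have /choice[s sE] k : exists s, (z (N + k).+1).1 = s * (z (N + k)%N).1.
  by apply: stabR; rewrite leq_addr.
(* The multipliers [s] exist only from [N] on, so [u] and [y] are indexed by the offset from [N],
   with [u 0 = 0]. *)
pose u k := \sum_(i < k) s i *: (c (N + i)%N).2.
pose y k := (z (N + k)%N).2 + (z (N + k)%N).1 *: u k.
have yE k : y k = (c (N + k)%N).1 *: y k.+1.
  (* The last summand of [u k.+1] yields the second term of [xE]: with a = r b and b = s a, one has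
     r b s m = a s m = b m. *)
  rewrite /y /u big_ord_recr /= addnS xE -addrA scalerDr; congr (_ + _).
  by rewrite scalerA -aE scalerDr addrC scalerA [_ * s k]mulrC -sE.
have [k|K stabM] := accM y; first by exists (c (N + k)%N).1.
exists (N + K)%N => n leNKn.
have leNn : (N <= n)%N := leq_trans (leq_addr K N) leNKn.
move: leNKn; rewrite -(subnKC leNn) leq_add2l; set k := (n - N)%N => leKk.
have [p pE] := stabM k leKk.
have [q [aq yq]] := common_multiplier _ _ _ _ _ _ _ _ _ (aE _) (sE k) (yE k) pE.
(* This is [(1, - u k.+1) * (q, 0) * (1, u k)]: pass from x to y, multiply by [q], and pass back. *)
exists (q, q *: (u k - u k.+1)).
rewrite -addnS [LHS]surjective_pairing; congr pair; rewrite /= ?addnS //.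
apply: (addIr ((z (N + k).+1).1 *: u k.+1)); move: yq; rewrite /y addnS => ->.
rewrite aq !(scalerDr, scalerBr, scalerN) !scalerA -addrA [_ * q]mulrC.
by rewrite subrK.
Qed.

Theorem theorem2 (R : comPzRingType) (M : lmodType R) :
  ACCP (idealization R M) <-> ACCP R /\ ACCC R M.
Proof.
split=> [accZ | [accR accM]]; last exact: ACCP_idealization.
split; [exact: ACCP_idealization_base accZ | exact: ACCP_idealization_module accZ].
Qed.
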